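(* Let $n\ge 11$, let $X_1,\ldots,X_n$ be independent standard Gaussian random variables, and let $X_{(1)}=\max(X_1,\ldots,X_n)$. Then $$\operatorname{Var}[X_{(1)}]\le\frac{8/\log 2}{\log(n/2)-\log\left(1+4\log\log(n/2)\right)}+2^{-n}+\exp\left(-\frac{n}{8}\right)+\frac{4\pi}{n}.$$
   Context: $\log$ is the natural logarithm. *)

(* Defs.v *)
From mathcomp Require Import all_boot all_order all_algebra.
From mathcomp Require Import all_classical all_reals all_analysis.
Import Order.TTheory GRing.Theory Num.Theory.
Import numFieldNormedType.Exports.

Set Implicit Arguments.
Unset Strict Implicit.
Unset Printing Implicit Defensive.

Local Open Scope classical_set_scope.
Local Open Scope ring_scope.

Section Defs.
Context d (T : measurableType d) (R : realType) (P : probability T R).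

Definition mutually_independent (I : finType) (X : I -> {RV P >-> R}) : Prop :=
  forall (J : {set I}) (A : I -> set R), (forall i, measurable (A i)) ->
    P (\bigcap_(i in [set` J]) (X i @^-1` A i)) =
    (\prod_(i in J) P (X i @^-1` A i))%E.

(* The laws are compared on Borel sets only: a measure is a function on all
   subsets, and its values outside the sigma-algebra are irrelevant. *)
Definition standard_gaussian (X : {RV P >-> R}) : Prop :=
  forall A : set R, measurable A ->
    distribution P X A = normal_prob (0 : R) (1 : R) A.

End Defs.

Arguments mutually_independent {d T R} P {I} X.
Arguments standard_gaussian {d T R} P X.

(* The iterated maximum is seeded with the first entry, so that for 0 < n the
   seed does not affect the result; the value 0 only occurs for n = 0. *)
Definition max_family (R : realType) (n : nat) (x : 'I_n -> R) : R :=
  \big[Num.max/head 0 (codom x)]_(i < n) x i.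

Lemma max_familyP (R : realType) (n : nat) (x : 'I_n -> R) : (0 < n)%N ->
  (forall i, x i <= max_family x) /\ (exists i, max_family x = x i).
Proof.
case: n x => // n x _; split=> [i|]; first exact: (le_bigmax _ x).
have [j xj] : exists j, head 0 (codom x) = x j.
  by exists ord0; rewrite codomE enum_ordSl.
rewrite /max_family xj; apply: (big_ind (fun y => exists i, y = x i)) => [|_ _ [i ->] [k ->]|i _].
- by exists j.
- by case: (leP (x i) (x k)) => _; [exists k|exists i].
- by exists i.
Qed.

(* Main.v *)
(* The variance is at most E (M - c)^2, where M is the maximum and c is the
   quantile with n Q(c) = 1, Q being the standard Gaussian tail. Translating the
   Gaussian density gives Q(c - s) >= exp(c s - s^2/2) Q(c) for s >= 0. Hence
     P(M > c + s) <= n Q(c + s) <= exp(- c s),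
     P(M < c - s) = (1 - Q(c - s))^n <= exp(- c s / 2) / 2;
   the latter follows from (1 - p)^n <= 1 / (2 n p) when s <= c, and from
   1 - Q(c - s) = Q(s - c) <= exp(- (s - c)^2 / 2) / 2 when s >= c.
   Integrating these tails gives E (M - c)^2 <= 6 / c^2. Convexity of exp and
   E|Z| <= 1 give Q(t) >= exp(- t^2/2 - t) / 2, so L := log(n/2) is at most
   c^2/2 + c, whence c >= 1 and L <= 3/2 c^2. The variance is thus at most 9/L,
   which is below the first term of the bound because log 2 < 7/8 and
   0 < L - log(1 + 4 log L) <= L. *)
Require Import Defs.
From HB Require Import structures.
From mathcomp Require Import all_boot all_order all_algebra.
From mathcomp Require Import all_classical all_reals all_analysis.
From mathcomp Require Import measurable_realfun ring lra.
Import Order.TTheory GRing.Theory Num.Theory.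
Import numFieldNormedType.Exports.

Local Open Scope classical_set_scope.
Local Open Scope ring_scope.

(** * Numerical inequalities for exp and log *)

Section real_inequalities.
Context {R : realType}.
Implicit Types x y c : R.

Lemma ln2_lt : ln 2 < 7 / 8 :> R.
Proof.
rewrite -ltr_expR lnK ?posrE//.
(* Halving the exponent sharpens the tangent bound: exp(7/8) >= (23/16)^2 = 529/256 > 2. *)
have -> : 7 / 8 = 7 / 16 + 7 / 16 :> R by lra.
rewrite expRD; have := expR_ge1Dx (7 / 16 : R); nra.
Qed.

Lemma ln2_ge : 1 / 2 <= ln 2 :> R.
Proof.
rewrite -ler_expR lnK ?posrE//.
have h : 1 - 1 / 2 <= expR (- (1 / 2)) :> R by exact: expR_ge1Dx.
have e : expR (1 / 2) * expR (- (1 / 2)) = 1 :> R by exact: expRxMexpNx_1.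
have := expR_gt0 (1 / 2 : R); nra.
Qed.

Lemma expR1_ge2 : 2 <= expR 1 :> R.
Proof. by have := expR_ge1Dx (1 : R); lra. Qed.

(** The tangent of exp at 1 gives exp x >= e x >= 2 x. *)
Lemma expR_le_inv x : 0 < x -> expR (- x) <= 1 / (2 * x).
Proof.
move=> x0; rewrite expRN div1r lef_pV2 ?posrE ?expR_gt0 ?mulr_gt0//.
have -> : x = 1 + (x - 1) by lra.
rewrite expRD; have := expR_ge1Dx (x - 1); have := expR1_ge2.
have := expR_gt0 (x - 1); nra.
Qed.

Lemma exprn_onem_le x n : 0 <= x <= 1 -> (1 - x) ^+ n <= expR (- (n%:R * x)).
Proof.
move=> /andP[x0 x1]; rewrite -mulrN mulrC expRM_natr lerXn2r ?nnegrE ?expR_ge0//.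
  by rewrite subr_ge0.
exact: expR_ge1Dx.
Qed.

(** The eighth power of exp(-3/16) >= 13/16 gives exp(3/2) <= (16/13)^8 < 11/2. The value 11/2 is
    n/2 at n = 11, so log(n/2) >= 3/2 for all n >= 11. *)
Lemma expR32_le : expR (3 / 2) <= 11 / 2 :> R.
Proof.
have h : 1 - 3 / 16 <= expR (- (3 / 16)) :> R by exact: expR_ge1Dx.
have e : expR (3 / 2) * expR (- (3 / 16)) ^+ 8 = 1 :> R.
  by rewrite -expRM_natr -expRD -[RHS]expR0; congr expR; lra.
have h8 : (13 / 16) ^+ 8 <= expR (- (3 / 16)) ^+ 8 :> R.
  by rewrite lerXn2r ?nnegrE ?expR_ge0//; lra.
have := expR_gt0 (3 / 2 : R); move: e h8; set a := expR _; set b := _ ^+ 8.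
nra.
Qed.

Lemma ln_leB1 x : 0 < x -> ln x <= x - 1.
Proof.
move=> x0; rewrite -ler_expR lnK ?posrE//.
by have := expR_ge1Dx (x - 1); lra.
Qed.

Lemma ln_natr2_ge n : (11 <= n)%N -> 3 / 2 <= ln (n%:R / 2) :> R.
Proof.
move=> n11; have n11R : 11 <= n%:R :> R by rewrite ler_nat.
rewrite -ler_expR lnK ?posrE; last by lra.
by have := expR32_le; lra.
Qed.

(** Write n/2 = 4 (n/8) and bound log(n/8) by its tangent at 1. *)
Lemma ln_natr2_le n :
  (0 < n)%N -> ln (n%:R / 2) <= n%:R / 8 - 1 + 2 * ln 2 :> R.
Proof.
move=> n0; have n0R : 0 < n%:R :> R by rewrite ltr0n.
have -> : n%:R / 2 = n%:R / 8 * (2 * 2) :> R by lra.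
rewrite lnM ?posrE ?divr_gt0// (@lnM _ 2 2) ?posrE//.
have := @ln_leB1 (n%:R / 8); rewrite divr_gt0// => /(_ isT).
by set a := ln (_ / _); lra.
Qed.

Lemma denominator_bounds x : 3 / 2 <= x -> 0 < x - ln (1 + 4 * ln x) <= x.
Proof.
move=> x32; have lx0 : 0 <= ln x by rewrite ln_ge0//; lra.
apply/andP; split; last by rewrite gerDl oppr_le0 ln_ge0//; lra.
(* Positivity amounts to 1 + 4 log x < exp x. The left side is at most 4 x - 3, while exp x = 4
   exp(x - 2 log 2) >= 4 x + 4 - 8 log 2, which exceeds 4 x - 3 exactly because log 2 < 7/8. *)
rewrite subr_gt0 -ltr_expR lnK ?posrE; last by lra.
have lnx : ln x <= x - 1 by apply: ln_leB1; lra.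
have -> : expR x = expR (x - 2 * ln 2) * (2 * 2).
  have -> : 2 * 2 = expR (ln 2 + ln 2) :> R by rewrite expRD lnK ?posrE.
  by rewrite -expRD; congr expR; lra.
have := expR_ge1Dx (x - 2 * ln 2); have := ln2_lt; lra.
Qed.

Lemma quantile_bound x c : 3 / 2 <= x -> 0 <= c -> x <= c ^+ 2 / 2 + c ->
  6 / c ^+ 2 <= (8 / ln 2) / (x - ln (1 + 4 * ln x)).
Proof.
move=> x32 c0 xc; have /andP[D0 Dx] := denominator_bounds _ x32.
move: D0 Dx; set D := x - _ => D0 Dx.
(* For 0 <= c < 1 one would have c^2/2 + c < 3/2 <= x. *)
have c1 : 1 <= c.
  rewrite leNgt; apply/negP => c1.
  have : 0 < (1 - c) * (c + 3) by apply: mulr_gt0; lra.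
  lra.
have ln20 : 0 < ln 2 :> R by have := ln2_ge; lra.
apply: (@le_trans _ _ (9 / x)).
  rewrite ler_pdivlMr; last by lra.
  rewrite mulrAC ler_pdivrMr ?exprn_gt0//; last by lra.
  have : 0 <= (c - 1) * c by apply: mulr_ge0; lra.
  lra.
apply: (@le_trans _ _ (8 / ln 2 / x)).
  rewrite ler_pM2r ?invr_gt0; last by lra.
  by rewrite ler_pdivlMr//; have := ln2_lt; lra.
by rewrite ler_pM2l ?divr_gt0// lef_pV2 ?posrE//; lra.
Qed.

Lemma near_lower_tail_bound (n : nat) c s q :
  0 <= s <= c -> 0 <= q <= 1 ->
  expR (c * s - s ^+ 2 / 2) <= n%:R * q ->
  (1 - q) ^+ n <= expR (- (c * s / 2)) / 2.
Proof.
move=> /andP[s0 sc] q01 qge; apply: le_trans (exprn_onem_le _ _ q01) _.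
have nq0 := lt_le_trans (expR_gt0 _) qge.
apply: le_trans (expR_le_inv _ nq0) _.
rewrite div1r invfM mulrC ler_pM2r ?invr_gt0//.
rewrite expRN lef_pV2 ?posrE ?expR_gt0//; apply: le_trans qge.
(* Since s <= c, the exponent c s - s^2/2 is at least c s / 2. *)
have : 0 <= s * (c - s) by rewrite mulr_ge0//; lra.
by rewrite ler_expR; lra.
Qed.

(** Here [p] stands for Q(v) with v = s - c. In logarithms, c v <= c^2/4 + v^2 bounds c (c + v) / 2
    by 5/4 log(n/2) + v^2/2, and log(n/2) <= n/8 - 1 + 2 log 2; this is absorbed by n (v^2/2 + log
    2) because log 2 >= 1/2 and n >= 11. *)
Lemma far_lower_tail_bound (n : nat) c v p : (11 <= n)%N -> 0 <= p ->
  c ^+ 2 / 2 <= ln (n%:R / 2) -> p <= expR (- (v ^+ 2 / 2)) / 2 ->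
  p ^+ n <= expR (- (c * (c + v) / 2)) / 2.
Proof.
move=> n11 p0 cL ph.
have n11R : 11 <= n%:R :> R by rewrite ler_nat.
have half y : expR y / 2 = expR (y - ln 2) :> R.
  by rewrite expRD expRN lnK ?posrE.
apply: (@le_trans _ _ ((expR (- (v ^+ 2 / 2)) / 2) ^+ n)).
  by rewrite lerXn2r ?nnegrE ?divr_ge0 ?expR_ge0.
rewrite !half -expRM_natr ler_expR.
have nL : ln (n%:R / 2) <= n%:R / 8 - 1 + 2 * ln 2 :> R.
  by apply: ln_natr2_le; apply: leq_trans n11.
have := ln2_ge; have : 0 <= (c / 2 - v) ^+ 2 by exact: sqr_ge0.
have : 0 <= (n%:R - 11) * v ^+ 2 by rewrite mulr_ge0 ?sqr_ge0//; lra.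
move: cL nL; set L := ln (_ / 2); set l := ln 2 => cL nL nv cv l12.
have : 0 <= (n%:R - 11) * (l - 1 / 2) by rewrite mulr_ge0//; lra.
have : 0 <= v ^+ 2 by exact: sqr_ge0.
lra.
Qed.

End real_inequalities.

(** * The Gaussian tail: translation, symmetry and upper bound *)

Section gaussian_tail.
Context {R : realType}.
Implicit Types a c s t v x : R.

Local Notation mu := (@lebesgue_measure R).
Local Notation f := (normal_pdf (0 : R) 1).

Lemma std_normal_pdfE x : f x = normal_peak 1 * expR (- (x ^+ 2 / 2)).
Proof.
by rewrite normal_pdfE ?oner_neq0// /normal_fun subr0 expr1n mulNr.
Qed.

Lemma std_normal_peak_le : normal_peak (1 : R) <= 1 / 2.
Proof.
rewrite div1r /normal_peak expr1n mul1r lef_pV2 ?posrE//; last first.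
  by rewrite sqrtr_gt0 mulrn_wgt0// pi_gt0.
rewrite -(@ler_pXn2r _ 2) ?nnegrE ?sqrtr_ge0// sqr_sqrtr; last first.
  by rewrite mulrn_wge0// pi_ge0.
have := @pi_ge2 R; lra.
Qed.

Lemma measurable_EFin_std_normal_pdf (D : set R) :
  measurable_fun D (EFin \o f).
Proof.
by apply: measurable_funTS; apply/measurable_EFinP; exact: measurable_normal_pdf.
Qed.

Lemma integral_shift (g : R -> R) a s :
  continuous g -> (forall x, 0 <= g x) ->
  (\int[mu]_(x in `[(a + s)%R, +oo[) (g x)%:E =
   \int[mu]_(x in `[a, +oo[) (g (x + s)%R)%:E)%E.
Proof.
move=> cg g0.
have D1 : ((fun x : R => x + s)^`())%classic = cst 1.
  by apply/funext => x; rewrite derive1E derive_val addr0.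
rewrite (@increasing_ge0_integration_by_substitutiony _ (fun x => x + s) g a).
- by apply: eq_integral => x _ /=; rewrite D1/= mulr1.
- by move=> x y _ _; rewrite ltrD2r.
- by rewrite D1 => x _; exact: cst_continuous.
- by rewrite D1; exact: is_cvg_cst.
- by rewrite D1; exact: is_cvg_cst.
- split; first by [].
  apply: cvg_at_right_filter; apply: cvgD; [exact: cvg_id|exact: cvg_cst].
- exact: cvg_addrr.
- exact: continuous_subspaceT.
- by [].
Qed.

Definition gaussian_tail t : R := fine (normal_prob (0 : R) 1 `[t, +oo[%classic).
Local Notation Q := gaussian_tail.

Lemma gaussian_tailE t :
  (\int[mu]_(x in `[t, +oo[) (f x)%:E = (Q t)%:E)%E.
Proof. by rewrite /gaussian_tail fineK// fin_num_measure. Qed.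

Lemma gaussian_tail01 t : 0 <= Q t <= 1.
Proof.
rewrite -!lee_fin -gaussian_tailE; apply/andP; split.
  exact: (measure_ge0 (normal_prob 0 1)).
exact: (probability_le1 (normal_prob 0 1)).
Qed.

(** The translated density is f(x - s) = exp(x s - s^2/2) f(x), and x s >= c s on the ray x >= c. *)
Lemma gaussian_tail_shift c s : 0 <= s ->
  expR (c * s - s ^+ 2 / 2) * Q c <= Q (c - s).
Proof.
move=> s0; rewrite -lee_fin EFinM -!gaussian_tailE.
rewrite integral_shift; [|exact: continuous_normal_pdf|exact: normal_pdf_ge0].
rewrite -ge0_integralZl//=; last 2 first.
- exact: measurable_EFin_std_normal_pdf.
- by move=> x _; rewrite lee_fin normal_pdf_ge0.
apply: ge0_le_integral => //=.
- by move=> x _; rewrite -EFinM lee_fin mulr_ge0// ?expR_ge0 ?normal_pdf_ge0.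
- apply/measurable_EFinP; apply: measurable_funM => //.
  by apply/measurable_EFinP; exact: measurable_EFin_std_normal_pdf.
- apply/measurable_EFinP; apply: measurable_funTS.
  apply: measurableT_comp; first exact: measurable_normal_pdf.
  exact: measurable_funD.
move=> x; rewrite in_itv/= andbT => cx.
rewrite -EFinM lee_fin !std_normal_pdfE mulrCA.
rewrite ler_pM2l ?normal_peak_gt0 ?oner_neq0//.
have : 0 <= s * (x - c) by rewrite mulr_ge0//; lra.
by rewrite -expRD ler_expR; lra.
Qed.

Lemma gaussian_tail_symmetric v :
  normal_prob (0 : R) 1 `]-oo, (- v)[%classic = (Q v)%:E.
Proof.
rewrite -gaussian_tailE /normal_prob integral_itv_bndo_bndc; last first.
  exact: measurable_EFin_std_normal_pdf.
have -> := @ge0_integration_by_substitutionNy R f v.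
- by apply: eq_integral => x _; rewrite /= !std_normal_pdfE sqrrN.
- by apply: continuous_subspaceT; exact: continuous_normal_pdf.
- by move=> x _; exact: normal_pdf_ge0.
Qed.

Lemma gaussian_head t :
  normal_prob (0 : R) 1 `]-oo, t[%classic = (1 - Q t)%:E.
Proof.
rewrite EFinB -gaussian_tailE -(@probability_setT _ _ _ (normal_prob (0 : R) 1)).
rewrite -[X in (_ - X)%E]/(normal_prob (0 : R) 1 `[t, +oo[%classic).
rewrite -(setUv `]-oo, t[%classic) measureU ?setICr//; last exact: measurableC.
by rewrite setCitvl addeK// fin_num_measure.
Qed.

Lemma gaussian_tailN v : Q v = 1 - Q (- v).
Proof. by apply: EFin_inj; rewrite -gaussian_tail_symmetric gaussian_head. Qed.

Lemma gaussian_tail0 : Q 0 = 1 / 2.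
Proof. by have := gaussian_tailN 0; rewrite oppr0; lra. Qed.

(** Translation by v carries the ray at v to the ray at 0, where Q(0) = 1/2 by symmetry. *)
Lemma gaussian_tail_le v : 0 <= v -> Q v <= expR (- (v ^+ 2 / 2)) / 2.
Proof.
move=> v0; have := gaussian_tail_shift v v v0; rewrite subrr gaussian_tail0.
have -> : v * v - v ^+ 2 / 2 = v ^+ 2 / 2 by lra.
move=> h; rewrite -(ler_pM2l (expR_gt0 (v ^+ 2 / 2))).
by apply: le_trans h _; rewrite mulrA expRxMexpNx_1.
Qed.

End gaussian_tail.

(** * Explicit integrals, the lower bound on the tail, and existence of quantiles *)

Section gaussian_quantile.
Context {R : realType}.
Implicit Types a b c s t v x : R.

Local Notation mu := (@lebesgue_measure R).
Local Notation f := (normal_pdf (0 : R) 1).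
Local Notation Q := gaussian_tail.

(** Serves for the limits at infinity of the antiderivatives in the two integrals below. *)
Lemma cvg0_le_inv (g : R -> R) (k : R) :
  (forall x, 0 < x -> 0 <= g x <= k / x) -> g x @[x --> +oo] --> (0 : R).
Proof.
move=> gk; apply: (@squeeze_cvgr _ _ _ _ (cst 0) (fun x => k / x)).
- near=> x; apply: gk; near: x; exact: nbhs_pinfty_gt.
- exact: cvg_cst.
- rewrite -[X in _ --> X](mulr0 k); apply: cvgMl_tmp.
  apply/gtr0_cvgV0; last exact: cvg_id.
  exact: nbhs_pinfty_gt.
Unshelve. all: by end_near. Qed.

(** The square root appears because the tail of (M - c)^2 at r is the tail of |M - c| at sqrt r. *)
Lemma integral_expR_sqrt a : 0 < a ->
  (\int[mu]_(x in `[0%R, +oo[) (expR (- (a * Num.sqrt x)))%:E =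
   (2 / a ^+ 2)%:E)%E.
Proof.
move=> a0; have an0 : a != 0 by rewrite gt_eqF.
have cE (k : R) : continuous (fun x => expR (- (k * Num.sqrt x))).
  move=> x; apply: (cvg_comp _ expR); last exact: continuous_expR.
  by apply: cvgN; apply: cvgMl_tmp; exact: sqrt_continuous.
(* The antiderivative comes from substituting x = u^2 and integrating 2 u exp(-a u) by parts. *)
pose G x := - (2 / a ^+ 2) * (1 + a * Num.sqrt x) * expR (- (a * Num.sqrt x)).
have dG x : 0 < x -> is_derive x (1 : R) G (expR (- (a * Num.sqrt x))).
  move=> x0; have Ds := is_derive1_sqrt x0.
  have D : is_derive x (1 : R) (fun y : R => - (a * Num.sqrt y))
      (- a * (2 * Num.sqrt x)^-1).
    by apply: is_derive_eq; rewrite mulNr.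
  have E := @is_derive1_comp R expR _ x _ _ (is_derive_expR (- (a * Num.sqrt x))) D.
  apply: is_derive_eq; rewrite /GRing.scale/=.
  have : Num.sqrt x != 0 by rewrite gt_eqF// sqrtr_gt0.
  by set s := Num.sqrt x => s0; field; rewrite an0 s0.
rewrite (@ge0_continuous_FTC2y _ _ G _ 0).
- by rewrite /G sqrtr0 mulr0 oppr0 expR0 addr0 !mulr1 -EFinB opprK add0r.
- by move=> x _; exact: expR_ge0.
- exact: continuous_subspaceT.
(* With y = a sqrt x, the constant 24/a^4 reduces the claim to (1 + y) exp(-y) <= 12/y^2, which
   follows from exp y >= 1 + y^3/6. *)
- apply/cvgNP; rewrite oppr0; apply: (@cvg0_le_inv _ (24 / a ^+ 4)) => x x0.
  rewrite /G !mulNr opprK.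
  set y := a * Num.sqrt x.
  have y0 : 0 < y by rewrite mulr_gt0// sqrtr_gt0.
  have -> : x = y ^+ 2 / a ^+ 2.
    by rewrite exprMn sqr_sqrtr ?ltW// mulrAC divff ?mul1r// expf_neq0.
  apply/andP; split.
    by rewrite mulr_ge0 ?expR_ge0// mulr_ge0 ?divr_ge0 ?sqr_ge0// addr_ge0// ltW.
  have -> : 24 / a ^+ 4 / (y ^+ 2 / a ^+ 2) = (2 / a ^+ 2) * (12 / y ^+ 2).
    by field; rewrite an0 gt_eqF.
  rewrite -[leLHS]mulrA ler_pM2l ?divr_gt0 ?exprn_gt0//.
  rewrite expRN ler_pdivrMr ?expR_gt0// mulrAC ler_pdivlMr ?exprn_gt0//.
  have := @expR_ge1Dxn R y 2 (ltW y0); rewrite (_ : 3`! = 6)%N//.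
  have : 0 <= y * (y - 1) ^+ 2 by rewrite mulr_ge0 ?sqr_ge0// ltW.
  by have := sqr_ge0 (y - 1); set e := expR y; lra.
- by move=> x x0; apply: ex_derive; exact: dG.
- apply: cvg_at_right_filter.
  apply: cvgM; last exact: cE.
  apply: cvgMl_tmp; apply: cvgD; first exact: cvg_cst.
  by apply: cvgMl_tmp; exact: sqrt_continuous.
- move=> x; rewrite in_itv/= andbT => x0.
  by rewrite derive1E; apply: derive_val; exact: dG.
Qed.

(** The integral is half of E|Z|. As -f is an antiderivative of x f(x), it equals f(0), the peak of
    the density. *)
Lemma half_gaussian_mean :
  (\int[mu]_(x in `[0%R, +oo[) (x * f x)%:E <= (1 / 2)%:E)%E.
Proof.
have df x : is_derive x (1 : R) (fun x => - f x) (x * f x).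
  have -> : (fun x => - f x) =
      (fun x => - (normal_peak 1 * expR (- (x ^+ 2 / 2)))).
    by apply/funext => y; rewrite std_normal_pdfE.
  have D : is_derive x (1:R) (fun y : R => - (y ^+ 2 / 2)) (- x).
    by apply: is_derive_eq; rewrite /GRing.scale/=; lra.
  have E := @is_derive1_comp R expR _ x _ _ (is_derive_expR (- (x ^+ 2 / 2))) D.
  by apply: is_derive_eq; rewrite std_normal_pdfE /GRing.scale/=; ring.
rewrite (@ge0_continuous_FTC2y _ _ (fun x => - f x) _ 0).
- rewrite -EFinB opprK add0r lee_fin std_normal_pdfE expr0n mul0r oppr0 expR0 mulr1.
  exact: std_normal_peak_le.
- by move=> x x0; rewrite mulr_ge0 ?normal_pdf_ge0.
- apply: continuous_subspaceT => x.
  by apply: cvgM; [exact: cvg_id|exact: continuous_normal_pdf].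
- apply/cvgNP; rewrite oppr0; apply: (@cvg0_le_inv _ 1) => x x0.
  rewrite opprK normal_pdf_ge0/= std_normal_pdfE.
  have h : expR (- (x ^+ 2 / 2)) <= 1 / x.
    rewrite div1r expRN lef_pV2 ?posrE ?expR_gt0//.
    have := expR_ge1Dx (x ^+ 2 / 2); have := sqr_ge0 (x - 1); lra.
  apply: le_trans h; rewrite ler_piMl ?expR_ge0//.
  by have := @std_normal_peak_le R; lra.
- by move=> x x0; apply: ex_derive; exact: df.
- by apply: cvg_at_right_filter; apply: cvgN; exact: continuous_normal_pdf.
- by move=> x _; rewrite derive1E; apply: derive_val; exact: df.
Qed.

(** With k = exp(-(t^2/2 + t)), the translated density satisfies f(x + t) >= k (1 + t - t x) f(x).
    Over x >= 0, f has mass 1/2 and x f(x) has integral at most 1/2, so the terms in t leave at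
    least k/2. *)
Lemma gaussian_tail_ge t : 0 <= t -> expR (- (t ^+ 2 / 2 + t)) / 2 <= Q t.
Proof.
move=> t0; set k := expR _.
have k0 : 0 <= k by exact: expR_ge0.
have mf (D : set R) : measurable_fun D f.
  by apply: measurable_funTS; exact: measurable_normal_pdf.
have mshift (D : set R) : measurable_fun D (fun x => f (x + t)).
  apply: measurable_funTS.
  apply: measurableT_comp; first exact: measurable_normal_pdf.
  exact: measurable_funD.
have mxf (D : set R) : measurable_fun D (fun x => x * f x).
  by apply: measurable_funM.
(* The negative term k t x f(x) is moved to the other side, so that only nonnegative functions are
   integrated. *)
suff : ((k * (1 + t))%:E * (1 / 2)%:E <= (Q t)%:E + (k * t)%:E * (1 / 2)%:E)%E.
  by rewrite -!EFinM -EFinD lee_fin; lra.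
apply: (@le_trans _ _ ((Q t)%:E + (k * t)%:E *
    \int[mu]_(x in `[0%R, +oo[) (x * f x)%:E)%E); last first.
  rewrite leeD2l// lee_wpmul2l//; last exact: half_gaussian_mean.
  by rewrite lee_fin mulr_ge0.
rewrite -{1}gaussian_tail0 -!gaussian_tailE -{2}(add0r t).
rewrite integral_shift; [|exact: continuous_normal_pdf|exact: normal_pdf_ge0].
have fge0 x : 0 <= f x by exact: normal_pdf_ge0.
rewrite -!ge0_integralZl//=; last 6 first.
- by apply/measurable_EFinP; exact: mxf.
- by move=> x; rewrite in_itv/= andbT => x0; rewrite lee_fin mulr_ge0.
- by rewrite lee_fin mulr_ge0.
- by apply/measurable_EFinP; exact: mf.
- by move=> x _; rewrite lee_fin.
- by rewrite lee_fin mulr_ge0// addr_ge0.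
rewrite -ge0_integralD//=; last 4 first.
- by move=> x _; rewrite lee_fin.
- by apply/measurable_EFinP; exact: mshift.
- move=> x; rewrite in_itv/= andbT => x0.
  by rewrite -EFinM lee_fin !mulr_ge0.
- by apply/measurable_EFinP; apply: measurable_funM => //; exact: mxf.
apply: ge0_le_integral => //=.
- by move=> x _; rewrite -EFinM lee_fin !mulr_ge0// addr_ge0.
- by apply/measurable_EFinP; apply: measurable_funM => //; exact: mf.
- apply/measurable_EFinP; apply: measurable_funD; first exact: mshift.
  by apply: measurable_funM => //; exact: mxf.
move=> x; rewrite in_itv/= andbT => x0.
rewrite -!EFinM -EFinD lee_fin.
(* exp (t (1 - x)) is bounded below by its tangent at x = 1. *)
have -> : f (x + t) = k * expR (t * (1 - x)) * f x.
  rewrite !std_normal_pdfE /k mulrCA -!expRD; congr (_ * expR _); lra.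
have : 0 <= k * f x * (expR (t * (1 - x)) - (1 + t * (1 - x))).
  by rewrite mulr_ge0 ?mulr_ge0// subr_ge0 expR_ge1Dx.
by set e := expR _; lra.
Qed.

(** The density is bounded by 1. This yields the continuity of Q that the intermediate value theorem
    asks for. *)
Lemma gaussian_tail_lipschitz a b : a <= b -> 0 <= Q a - Q b <= b - a.
Proof.
move=> ab.
have -> : Q a - Q b = fine (normal_prob (0 : R) 1 `[a, b[%classic).
  apply/eqP; rewrite subr_eq addrC; apply/eqP.
  rewrite /gaussian_tail -fineD ?fin_num_measure// -measureU//.
  - by rewrite setUC -itv_bndbnd_setU// bnd_simp.
  - rewrite -subset0 => x/=; rewrite !in_itv/= andbT => -[bx /andP[_]].
    by rewrite ltNge bx.
rewrite fine_ge0//= -lee_fin fineK ?fin_num_measure// /normal_prob.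
apply: (@le_trans _ _ (\int[mu]_(x in `[a, b[) 1%:E)%E).
  apply: ge0_le_integral => //=.
  - by move=> x _; rewrite lee_fin normal_pdf_ge0.
  - exact: measurable_EFin_std_normal_pdf.
  - move=> x _; rewrite lee_fin; apply: le_trans (normal_pdf_ub _ _ _) _ => //.
    by have := @std_normal_peak_le R; lra.
rewrite integral_cst//= mul1e lebesgue_measure_itv/= lte_fin.
by case: ltP => // _; rewrite lee_fin subr_ge0.
Qed.

Lemma continuous_gaussian_tail : continuous (Q : R -> R).
Proof.
have lip a b : `|Q a - Q b| <= `|a - b|.
  have [ab|/ltW ba] := leP a b.
    have /andP[? ?] := gaussian_tail_lipschitz _ _ ab.
    by rewrite ger0_norm// ler0_norm; lra.
  have /andP[? ?] := gaussian_tail_lipschitz _ _ ba.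
  by rewrite ler0_norm ?ger0_norm; lra.
move=> x; apply/cvgrPdist_le => e e0; near=> y.
apply: le_trans (lip _ _) _.
near: y; exact: cvgr_dist_le.
Unshelve. all: end_near. Qed.

Lemma gaussian_quantile (p : R) : 0 < p <= 1 / 2 -> exists2 c, 0 <= c & Q c = p.
Proof.
move=> /andP[p0 p2]; have V0 : 0 < p^-1 by rewrite invr_gt0.
(* The right endpoint V = 1/p works since 2 exp(V^2/2) >= 2 + V^2 >= V. *)
have QV : Q p^-1 <= p.
  apply: le_trans (gaussian_tail_le _ (ltW V0)) _.
  rewrite expRN -invfM -[leRHS]invrK lef_pV2 ?posrE ?mulr_gt0 ?expR_gt0//.
  have := expR_ge1Dx (p^-1 ^+ 2 / 2); have := sqr_ge0 (p^-1 - 1); lra.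
have [|c] := @IVT R Q 0 p^-1 p (ltW V0)
    (continuous_subspaceT continuous_gaussian_tail).
  by rewrite gaussian_tail0 ge_min le_max QV p2 orbT.
by rewrite in_itv/= => /andP[c0 _] Qc; exists c.
Qed.

End gaussian_quantile.

(** * Variance and second moment of a general random variable *)

Section second_moment.
Context {d : measure_display} {T : measurableType d} {R : realType}.
Variable P : probability T R.

Lemma Lfun2_expectation_sqr (Y : T -> R) : measurable_fun setT Y ->
  ('E_P[(fun w => (Y w ^+ 2)%R)] < +oo)%E -> Y \in Lfun P 2%:E.
Proof.
move=> mY EY; rewrite inE; apply/andP; split; rewrite inE//=.
rewrite /finite_norm unlock; apply: poweR_lty.
move: EY; rewrite unlock; congr (_ < _)%E.
by apply: eq_integral => w _; rewrite /= powR_mulrn// -normrX ger0_norm ?sqr_ge0.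
Qed.

(** Variance is invariant under translation, and that of Y - c is its second moment minus the square
    of its mean. If the second moment is infinite the bound is trivial; otherwise Y - c lies in L^2
    and the formula applies. *)
Lemma variance_le_sqr_dist (Y : T -> R) (c : R) : measurable_fun setT Y ->
  ('V_P[Y] <= 'E_P[(fun w => ((Y w - c) ^+ 2)%R)])%E.
Proof.
move=> mY; have [Efin|] := ltP 'E_P[(fun w => ((Y w - c) ^+ 2)%R)]%E +oo%E; last first.
  by rewrite leye_eq => /eqP ->; exact: leey.
have mYc : measurable_fun setT (fun w => Y w - c) by exact: measurable_funB.
have Yc2 := Lfun2_expectation_sqr _ mYc Efin.
rewrite [X in 'V_P[X]%E](_ : Y = (fun w => Y w - c) \+ cst c); last first.
  by apply/funext => w /=; rewrite subrK.
rewrite varianceD_cst_r// varianceE// -[leRHS]sube0 leeB//.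
have E1 := Lfun_subset12 (fin_num_measure P _ measurableT) Yc2.
by rewrite -(fineK (expectation_fin_num E1)) -EFin_expe lee_fin sqr_ge0.
Qed.

(** Layer-cake formula: E Y^2 is the integral over r >= 0 of P(Y^2 > r). *)
Lemma expectation_sqr_le_tail (Y : T -> R) (g : R -> R) (b : R) :
  measurable_fun setT Y -> measurable_fun setT g -> (forall r, 0 <= g r) ->
  (forall r, 0 <= r -> (P [set w | (r < Y w ^+ 2)%R] <= (g r)%:E)%E) ->
  (\int[lebesgue_measure]_(r in `[0%R, +oo[) (g r)%:E <= b%:E)%E ->
  ('E_P[(fun w => (Y w ^+ 2)%R)] <= b%:E)%E.
Proof.
move=> mY mg g0 tail intg.
have mY2 : measurable_fun setT (fun w => Y w ^+ 2) by exact: measurable_funX.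
pose m := isMeasurableFun.Build _ _ _ _ _ mY2.
pose Y2 : {RV P >-> R} := HB.pack (fun w => Y w ^+ 2) m.
change ('E_P[Y2] <= b%:E)%E.
rewrite ge0_expectation_ccdf; last by move=> w; exact: sqr_ge0.
apply: le_trans intg; apply: ge0_le_integral => //=.
- exact: measurable_funTS (ccdf_measurable _).
- by apply/measurable_EFinP; exact: measurable_funTS.
move=> r; rewrite in_itv/= andbT => r0.
apply: le_trans (tail r r0); rewrite [leLHS](_ : _ = P (Y2 @^-1` `]r, +oo[))//.
by rewrite (_ : Y2 @^-1` `]r, +oo[ = [set w | r < Y w ^+ 2])// set_itvoy.
Qed.

End second_moment.

(** * Distribution of the maximum *)

Section maximum.
Context {d : measure_display} {T : measurableType d} {R : realType}.
Variables (P : probability T R) (n : nat) (X : 'I_n -> {RV P >-> R}).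
Hypothesis n0 : (0 < n)%N.
Local Notation M w := (max_family (fun i => X i w)).
Local Notation Q := gaussian_tail.

Lemma measurable_max_family : measurable_fun setT (fun w => M w).
Proof.
(* Induction on the list of indices with the seed kept fixed. On the empty list only the seed
   remains, which for 0 < n is the random variable [X ord0]. *)
rewrite /max_family; elim: (index_enum _) => [|i s IH].
  under eq_fun do rewrite big_nil.
  case: (n) n0 X => // m _ Z; under eq_fun do rewrite codomE enum_ordSl/=.
  exact: measurable_funP.
under eq_fun do rewrite big_cons.
by apply: measurable_maxr => //; exact: measurable_funP.
Qed.

Hypothesis gaussX : forall i, standard_gaussian P (X i).

(** Union bound: some entry attains the maximum. *)
Lemma max_gaussian_tail_le (t : R) :
  (P [set w | (t < M w)%R] <= (n%:R * Q t)%:E)%E.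
Proof.
have mt i : measurable (X i @^-1` `[t, +oo[) by exact: measurable_funPTI.
apply: (@le_trans _ _ (\sum_(i < n) P (X i @^-1` `[t, +oo[))%E).
  rewrite fsbig_seq ?index_enum_uniq//; apply: content_sub_fsum => //.
  - have := measurable_max_family measurableT _ (measurable_itv `]t, +oo[).
    by rewrite setTI set_itvoy.
  - move=> w /= tM; have [_ [i Mi]] := max_familyP (fun i => X i w) n0.
    by exists i; rewrite /= ?mem_index_enum// in_itv/= andbT -Mi ltW.
rewrite (eq_bigr (fun=> (Q t)%:E)); last first.
  move=> i _; rewrite -[LHS]/(distribution P (X i) _) gaussX//.
  exact: gaussian_tailE.
by rewrite sumEFin sumr_const card_ord mulr_natl.
Qed.

(** The maximum is below t exactly when all entries are, so independence over the full index set
    gives a product of equal factors. *)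
Lemma max_gaussian_head (t : R) : mutually_independent P X ->
  (P [set w | (M w < t)%R] = ((1 - Q t) ^+ n)%:E)%E.
Proof.
move=> indep.
have -> : [set w | M w < t] =
    \bigcap_(i in [set` [set: 'I_n]%SET]) (X i @^-1` `]-oo, t[).
  apply/seteqP; split => w /=.
    move=> Mt i _ /=; rewrite in_itv/=; apply: le_lt_trans Mt.
    by have [] := max_familyP (fun i => X i w) n0.
  move=> Xt; have [_ [i ->]] := max_familyP (fun i => X i w) n0.
  by have := Xt i; rewrite /= inE in_itv/=; exact.
rewrite (indep _ (fun=> `]-oo, t[%classic))//.
rewrite (eq_bigr (fun=> (1 - Q t)%:E)); last first.
  move=> i _; rewrite -[LHS]/(distribution P (X i) _) gaussX//.
  exact: gaussian_head.
by rewrite prodEFin prodr_const cardsT card_ord.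
Qed.

End maximum.

(** * Tail estimates around the quantile c with n Q(c) = 1 *)

Section quantile_tails.
Context {R : realType}.
Variables (n : nat) (c : R).
Hypotheses (n11 : (11 <= n)%N) (c0 : 0 <= c).
Hypothesis cq : gaussian_tail c = n%:R^-1.
Local Notation Q := gaussian_tail.

Let nR0 : 0 < n%:R :> R.
Proof. by rewrite ltr0n; apply: leq_trans n11. Qed.

Lemma ln_natr2_le_quantile : ln (n%:R / 2) <= c ^+ 2 / 2 + c.
Proof.
rewrite -ler_expR lnK ?posrE ?divr_gt0//.
have := gaussian_tail_ge _ c0; rewrite cq expRN -invfM.
by rewrite lef_pV2 ?posrE ?mulr_gt0 ?expR_gt0// ler_pdivrMr.
Qed.

Lemma quantile_sqr_le : c ^+ 2 / 2 <= ln (n%:R / 2).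
Proof.
rewrite -ler_expR lnK ?posrE ?divr_gt0//.
have := gaussian_tail_le _ c0; rewrite cq expRN -invfM.
by rewrite lef_pV2 ?posrE ?mulr_gt0 ?expR_gt0// ler_pdivlMr.
Qed.

(** Translating from c + s back to c gives exp(c s + s^2/2) Q(c + s) <= Q(c) = 1/n. *)
Lemma quantile_upper_tail (s : R) :
  0 <= s -> n%:R * Q (c + s) <= expR (- (c * s)).
Proof.
move=> s0; have := gaussian_tail_shift (c + s) s s0.
rewrite addrK cq => h.
have {}h : expR ((c + s) * s - s ^+ 2 / 2) * (n%:R * Q (c + s)) <= 1.
  by rewrite mulrCA -ler_pdivlMl// mulr1.
rewrite -(ler_pM2l (expR_gt0 (c * s))) expRxMexpNx_1; apply: le_trans h.
rewrite ler_wpM2r ?ler_expR//; last by have := sqr_ge0 s; lra.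
by have /andP[q0 _] := gaussian_tail01 (c + s); rewrite mulr_ge0.
Qed.

Lemma quantile_lower_tail (s : R) : 0 <= s ->
  (1 - Q (c - s)) ^+ n <= expR (- (c * s / 2)) / 2.
Proof.
move=> s0; have [sc|/ltW cs] := leP s c.
  apply: near_lower_tail_bound; rewrite ?s0//; first exact: gaussian_tail01.
  have := gaussian_tail_shift c s s0.
  by rewrite cq (ler_pdivrMr _ _ nR0) (mulrC (Q _)).
have v0 : 0 <= s - c by rewrite subr_ge0.
have -> : 1 - Q (c - s) = Q (s - c) by rewrite (gaussian_tailN (s - c)) opprB.
have -> : c * s / 2 = c * (c + (s - c)) / 2 by rewrite subrKC.
apply: far_lower_tail_bound => //.
- by have /andP[] := gaussian_tail01 (s - c).
- exact: quantile_sqr_le.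
- exact: gaussian_tail_le.
Qed.

End quantile_tails.

(** * Second moment of the maximum about the quantile *)

Section max_second_moment.
Context {d : measure_display} {T : measurableType d} {R : realType}.
Variables (P : probability T R) (n : nat) (X : 'I_n -> {RV P >-> R}) (c : R).
Hypotheses (n11 : (11 <= n)%N) (c0 : 0 < c).
Hypothesis cq : gaussian_tail c = n%:R^-1.
Hypotheses (indep : mutually_independent P X)
  (gaussX : forall i, standard_gaussian P (X i)).
Local Notation M w := (max_family (fun i => X i w)).

Let n0 : (0 < n)%N. Proof. exact: leq_trans n11. Qed.

Lemma max_gaussian_sqr_dist_tail (r : R) : 0 <= r ->
  (P [set w | (r < (M w - c) ^+ 2)%R] <=
   (expR (- (c * Num.sqrt r)) + expR (- (c / 2 * Num.sqrt r)) / 2)%:E)%E.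
Proof.
move=> r0; set s := Num.sqrt r.
have mM := measurable_max_family P n X n0.
have mU : measurable [set w | (c + s < M w)%R].
  have := mM measurableT _ (measurable_itv `]c + s, +oo[).
  by rewrite setTI set_itvoy.
have mL : measurable [set w | (M w < c - s)%R].
  have := mM measurableT _ (measurable_itv `]-oo, c - s[).
  by rewrite setTI set_itvNyo.
have mD : measurable [set w | (r < (M w - c) ^+ 2)%R].
  have mg : measurable_fun setT (fun w => (M w - c) ^+ 2).
    by apply: measurable_funX; exact: measurable_funB.
  by have := mg measurableT _ (measurable_itv `]r, +oo[); rewrite setTI set_itvoy.
apply: (@le_trans _ _ (P ([set w | (c + s < M w)%R] `|`
    [set w | (M w < c - s)%R]))).
  apply: le_measure; rewrite ?inE//; first exact: measurableU.
  move=> w /=; rewrite -(sqr_sqrtr r0) -/s => h.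
  have [cM|Mc] := ltP (c + s) (M w); first by left.
  (* If c - s <= M <= c + s, both factors of s^2 - (M - c)^2 are nonnegative. *)
  right; rewrite ltNge; apply/negP => sM; move: h; apply/negP; rewrite -leNgt.
  by rewrite -subr_ge0 subr_sqr mulr_ge0; lra.
apply: le_trans (measureU2 _ _ _) _ => //; rewrite EFinD leeD//.
  apply: le_trans (max_gaussian_tail_le _ _ _ n0 gaussX _) _.
  by rewrite lee_fin quantile_upper_tail ?sqrtr_ge0.
have MlE := max_gaussian_head P n X n0 gaussX (c - s) indep.
apply: (@le_trans _ _ ((1 - gaussian_tail (c - s)) ^+ n)%:E).
  by rewrite -MlE.
rewrite lee_fin mulrAC.
by rewrite quantile_lower_tail ?sqrtr_ge0// ltW.
Qed.

Lemma max_gaussian_sqr_dist :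
  ('E_P[(fun w => ((M w - c) ^+ 2)%R)] <= (6 / c ^+ 2)%:E)%E.
Proof.
have mE (a : R) :
    measurable_fun [set: R] (fun r : R => expR (- (a * Num.sqrt r))).
  apply: continuous_measurable_fun => x.
  apply: (cvg_comp _ expR); last exact: continuous_expR.
  by apply: cvgN; apply: cvgMl_tmp; exact: sqrt_continuous.
have mE2 :
    measurable_fun [set: R] (fun r : R => expR (- (c / 2 * Num.sqrt r)) / 2).
  by apply: measurable_funM => //; exact: mE.
apply: (@expectation_sqr_le_tail _ _ _ P (fun w => M w - c)
  (fun r => expR (- (c * Num.sqrt r)) + expR (- (c / 2 * Num.sqrt r)) / 2)).
- by apply: measurable_funB => //; exact: measurable_max_family.
- exact: measurable_funD.
- by move=> r; rewrite addr_ge0 ?divr_ge0 ?expR_ge0.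
- exact: max_gaussian_sqr_dist_tail.
under eq_integral do rewrite EFinD.
rewrite ge0_integralD//=; last 2 first.
- by apply/measurable_EFinP; apply: measurable_funTS; exact: mE.
- by apply/measurable_EFinP; apply: measurable_funTS; exact: mE2.
under [X in (_ + X)%E]eq_integral do rewrite EFinM.
rewrite ge0_integralZr//=; last first.
- by apply/measurable_EFinP; apply: measurable_funTS; exact: mE.
(* The upper tail contributes 2/c^2 and the lower tail half of 2/(c/2)^2, that is 4/c^2. *)
rewrite !integral_expR_sqrt ?divr_gt0// -EFinM -EFinD lee_fin.
by rewrite le_eqVlt; apply/orP; left; apply/eqP; field; rewrite gt_eqF.
Qed.

End max_second_moment.

(** * The variance bound *)

Theorem proposition4p7 (d : measure_display) (T : measurableType d)
    (R : realType) (P : probability T R) (n : nat) (hn : (11 <= n)%N)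
    (X : 'I_n -> {RV P >-> R})
    (hindep : mutually_independent P X)
    (hgauss : forall i, standard_gaussian P (X i)) :
  ('V_P[(fun w : T => max_family (fun i => X i w))] <=
    ((8 / ln 2) / (ln (n%:R / 2) - ln (1 + 4 * ln (ln (n%:R / 2))))
     + 2 ^- n + expR (- (n%:R / 8)) + 4 * pi / n%:R)%:E)%E.
Proof.
have n0 : (0 < n)%N by apply: leq_trans hn.
have nR : 11 <= n%:R :> R by rewrite ler_nat.
have [|c c0 cq] := @gaussian_quantile R n%:R^-1.
  rewrite invr_gt0 div1r lef_pV2 ?posrE; lra.
have L32 := @ln_natr2_ge R n hn.
have Lc := ln_natr2_le_quantile n c hn c0 cq.
(* At c = 0 the bound log(n/2) <= c^2/2 + c would contradict log(n/2) >= 3/2. *)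
have c_gt0 : 0 < c.
  rewrite lt_neqAle c0 andbT; apply/eqP => c00.
  by move: Lc; rewrite -c00 expr0n/= mul0r addr0; lra.
have E6 := max_gaussian_sqr_dist P n X c hn c_gt0 cq hindep hgauss.
apply: le_trans (variance_le_sqr_dist P _ c (measurable_max_family P n X n0)) _.
apply: le_trans E6 _.
rewrite lee_fin; apply: le_trans (quantile_bound _ _ L32 c0 Lc) _.
have : 0 <= 2 ^- n :> R by rewrite invr_ge0 exprn_ge0.
have : 0 <= 4 * pi / n%:R :> R by rewrite divr_ge0// mulr_ge0// pi_ge0.
by have := expR_ge0 (- (n%:R / 8) : R); lra.
Qed.
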